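(* Let $D$ be a division ring which is finite dimensional over its center $F$, where the characteristic of $F$ is either zero or a prime $p$ such that $p\nmid \dim_F D$. For any positive integer $n$, there exists a depth-$n$ iterated additive commutator which generates a maximal subfield of $D$; that is, there exist $a_1,\dots,a_{2^n}\in D$ such that, with $a=v_n(a_1,\dots,a_{2^n})$, the field $F(a)$ is a maximal subfield of $D$.
   Context: The polynomials $v_n$ in $2^n$ noncommuting indeterminates are defined recursively by $v_1(x_1,x_2)=[x_1,x_2]=x_1x_2-x_2x_1$ and, for $n\ge 2$, $$v_n(x_1,\dots,x_{2^n})=v_1\bigl(v_{n-1}(x_1,\dots,x_{2^{n-1}}),\,v_{n-1}(x_{2^{n-1}+1},\dots,x_{2^n})\bigr).$$ A depth-$n$ iterated additive commutator in $D$ is an element of the form $v_n(a_1,\dots,a_{2^n})$ with $a_1,\dots,a_{2^n}\in D$. For $a\in D$, $F(a)$ is the subfield of $D$ generated by $F$ and $a$. A subfield $K$ of $D$ is called a maximal subfield if $K$ is equal to its own centralizer in $D$. Division rings are not assumed to be noncommutative. *)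

(* Defs.v *)
From HB Require Import structures.
From mathcomp Require Import all_boot all_order all_algebra all_field.

Set Implicit Arguments.
Unset Strict Implicit.
Unset Printing Implicit Defensive.

Import GRing.Theory.
Local Open Scope ring_scope.

Definition add_comm (R : pzRingType) (x y : R) : R := x * y - y * x.

(* The value v_n(s_0, ..., s_{2^n - 1}) of the n-th iterated commutator
   polynomial, meaningful for sequences s of length 2^n. Starting from
   v_0(x) = x yields v_1(x_1, x_2) = [x_1, x_2]. *)
Fixpoint iter_comm (R : pzRingType) (n : nat) (s : seq R) : R :=
  if n is m.+1 then
    add_comm (iter_comm m (take (2 ^ m) s)) (iter_comm m (drop (2 ^ m) s))
  else head 0 s.

Definition is_division_ring (D : unitRingType) : Prop :=
  forall x : D, x != 0 -> x \is a GRing.unit.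

(* Subsets of D are Prop-valued predicates. Closure under inverse needs no
   exception at 0, since 0^-1 = 0. *)
Definition is_subfield (D : unitRingType) (K : D -> Prop) : Prop :=
  [/\ K 1,
      forall x y, K x -> K y -> K (x - y),
      forall x y, K x -> K y -> K (x * y),
      forall x, K x -> K x^-1
    & forall x y, K x -> K y -> x * y = y * x].

Definition centralizer (D : pzRingType) (K : D -> Prop) : D -> Prop :=
  fun x => forall y, K y -> x * y = y * x.

Definition is_maximal_subfield (D : unitRingType) (K : D -> Prop) : Prop :=
  is_subfield K /\ (forall x, K x <-> centralizer K x).

(* F(a): the intersection of all subfields of D containing F (embedded as
   the scalars c%:A) and a. *)
Definition gen_subfield (F : fieldType) (D : falgType F) (a : D) : D -> Prop :=
  fun x => forall K : D -> Prop,
    is_subfield K -> (forall c : F, K c%:A) -> K a -> K x.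

(* Main.v *)
Require Import Defs.
From HB Require Import structures.
From mathcomp Require Import all_boot all_order all_algebra all_field ring.
From Stdlib Require Import Classical.

(* Let K be a maximal commutative subalgebra of D and m the left K-dimension of D.
   Right multiplication embeds D in M_m(K) (row vectors), and the scalar extension
   of D to K becomes all of M_m(K): sandwich maps y |-> sum k_i y a_i exhaust
   End_F(D), and those commuting with K have their k_i in the centralizer of K,
   that is in K. In particular dim D = m^2, so m is invertible in K.

   Over K there is a triple e, h, f of matrices with [h, e] = e, [e, f] = h,
   [f, h] = f, where e is the regular nilpotent Jordan block and h is diagonal.
   Each of the three is a commutator of two of them, hence each is a value of v_n
   for every n. The first basis vector u is cyclic for e, so the polynomial
   det (u, u v_n, ..., u v_n^(m-1)) does not vanish identically on M_m(K), hence
   not on D either, D being an F-form of M_m(K) and F being infinite (if F is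
   finite then D = F by Wedderburn, and m = 1). If the determinant is nonzero at
   a = v_n(a_1, ..., a_(2^n)), everything commuting with a is a combination of
   powers of a with coefficients in K, and for elements of D, in F. *)

Set Implicit Arguments.
Unset Strict Implicit.
Unset Printing Implicit Defensive.

Import GRing.Theory.
Local Open Scope ring_scope.

(** * Iterated commutators and the triple e, h, f *)

Lemma iter_comm_map (R S : pzRingType) (f : R -> S)
    (fB : {morph f : x y / x - y}) (fM : {morph f : x y / x * y}) n (s : seq R) :
  iter_comm n (map f s) = f (iter_comm n s).
Proof.
have f0 : f 0 = 0 by rewrite -(subr0 0) fB subrr.
elim: n s => [|n IHn] s; first by case: s.
by rewrite /= -map_take -map_drop !IHn /add_comm fB !fM.
Qed.

Lemma iter_commS_add_comm (R : pzRingType) n (s t : seq R) :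
  size s = (2 ^ n)%N ->
  iter_comm n.+1 (s ++ t) = add_comm (iter_comm n s) (iter_comm n t).
Proof. by move=> szs; rewrite /= take_size_cat ?drop_size_cat. Qed.

Lemma sl2_triple_iter_comm (R : pzRingType) (e h f : R) :
  add_comm h e = e -> add_comm e f = h -> add_comm f h = f ->
  forall n x, x \in [:: e; h; f] ->
  exists2 s, size s = (2 ^ n)%N & iter_comm n s = x.
Proof.
move=> he ef fh; elim=> [|n IHn] x; first by exists [:: x].
have glue y z : y \in [:: e; h; f] -> z \in [:: e; h; f] ->
    exists2 s, size s = (2 ^ n.+1)%N & iter_comm n.+1 s = add_comm y z.
  move=> /IHn[s szs <-] /IHn[t szt <-]; exists (s ++ t).
    by rewrite size_cat szs szt expnS mul2n addnn.
  exact: iter_commS_add_comm.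
by rewrite !inE => /or3P[] /eqP->; [rewrite -he|rewrite -ef|rewrite -fh];
  apply: glue; rewrite !inE eqxx ?orbT.
Qed.

(* The subdiagonal of sl2_f holds the partial sums of the diagonal of sl2_h; the
   shift c makes sl2_h traceless, so that the last partial sum vanishes. *)
Section Sl2.

Variables (K : fieldType) (m : nat).
Hypothesis m_neq0 : m.+1%:R != 0 :> K.

Let c : K := (\sum_(i < m.+1) i%:R) / m.+1%:R.
Let h (i : nat) : K := c - i%:R.
Let g (j : nat) : K := \sum_(i < j.+1) h i.

Let sum_h : g m = 0.
Proof.
by rewrite /g big_split /= sumrN sumr_const card_ord -mulr_natr divfK // subrr.
Qed.

Definition sl2_e : 'M[K]_m.+1 := \matrix_(i, j) (j == i.+1 :> nat)%:R.
Definition sl2_h : 'M[K]_m.+1 := diag_mx (\row_i h i).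
Definition sl2_f : 'M[K]_m.+1 := \matrix_(i, j) (g j *+ (i == j.+1 :> nat)).

Lemma sl2_he : add_comm sl2_h sl2_e = sl2_e.
Proof.
apply/matrixP=> i j; rewrite /add_comm [_ * _]mul_diag_mx [X in _ - X]mul_mx_diag.
rewrite !mxE; case: eqP => [->|_]; last by rewrite mulr0 mul0r subrr.
rewrite mulr1 mul1r /h -[i.+1%:R]natr1 [true%:R]mulr1n; ring.
Qed.

Lemma sl2_ef : add_comm sl2_e sl2_f = sl2_h.
Proof.
have gE j : g j.+1 = g j + h j.+1 by rewrite /g big_ord_recr.
have g0 : g 0 = h 0 by rewrite /g big_ord1.
apply/matrixP=> i j.
have -> : sl2_h i j = h i *+ (i == j) by rewrite !mxE.
have efE : (sl2_e *m sl2_f) i j = g i *+ (i == j).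
  (* Row [i] of [sl2_e] has its 1 in column [i.+1], which exists only for [i < m]; in the last row
     the product is 0, in agreement with [g m = 0]. *)
  rewrite mxE; have [lt_im|] := ltnP i m; last first.
    rewrite leq_eqVlt ltnNge -ltnS ltn_ord orbF => /eqP m_i.
    rewrite -m_i sum_h mul0rn big1 // => k _; rewrite !mxE -m_i.
    by rewrite ltn_eqF ?ltn_ord // mul0r.
  pose k : 'I_m.+1 := Ordinal (lt_im : i.+1 < m.+1)%N.
  rewrite (bigD1 k) //= big1 ?addr0 => [|k' /negPf k'k].
    rewrite !mxE eqxx mul1r /= eqSS (inj_eq val_inj).
    by case: eqP => [->|].
  by rewrite !mxE -[i.+1]/(val k) (inj_eq val_inj) k'k mul0r.
have feE : (sl2_f *m sl2_e) i j = (g i - h i) *+ (i == j).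
  (* Only [k = i.-1] contributes, with [g i.-1 = g i - h i]; row 0 of [sl2_f] is zero, in agreement
     with [g 0 = h 0]. *)
  rewrite mxE; case: (posnP i) => [i0|i_gt0].
    rewrite i0 g0 subrr mul0rn big1 // => k _.
    by rewrite !mxE i0 mul0r.
  have lt_im : (i.-1 < m.+1)%N by rewrite prednK // ltnW.
  pose k : 'I_m.+1 := Ordinal lt_im.
  rewrite (bigD1 k) //= big1 ?addr0 => [|k' /negPf k'k].
    rewrite !mxE /= prednK // eqxx -{3}(prednK i_gt0) gE prednK //.
    by rewrite addrK mulr_natr eq_sym -(inj_eq val_inj).
  rewrite !mxE -{1}(prednK i_gt0) eqSS -[i.-1]/(val k) (inj_eq val_inj).
  by rewrite eq_sym k'k mul0r.
rewrite /add_comm [LHS]mxE [(sl2_e * _) i j]efE mxE [(sl2_f * _) i j]feE.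
by rewrite -mulrnBl subKr.
Qed.

Lemma sl2_fh : add_comm sl2_f sl2_h = sl2_f.
Proof.
apply/matrixP=> i j; rewrite /add_comm [X in _ - X]mul_diag_mx [_ * _]mul_mx_diag.
rewrite !mxE; case: eqP => [->|_]; last by rewrite mulr0 mul0r subrr.
rewrite /h mulr1n -[j.+1%:R]natr1; ring.
Qed.

Lemma sl2_e_cyclic (i : 'I_m.+1) :
  (delta_mx 0 0 : 'rV_m.+1) *m sl2_e ^+ i = delta_mx 0 i.
Proof.
case: i => i; elim: i => [|i IHi] lt_im.
  by rewrite mulmx1; congr delta_mx; apply: val_inj.
rewrite exprSr mulmxA (IHi (ltnW lt_im)) -rowE.
by apply/rowP=> j; rewrite !mxE eqxx -(inj_eq val_inj).
Qed.

End Sl2.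

(** * Krylov matrices and centralizers *)

Definition krylov_mx (R : comPzRingType) m (u : 'rV[R]_m) (A : 'M[R]_m) : 'M[R]_m :=
  \matrix_(i < m) (u *m A ^+ i).

Lemma map_krylov_mx (R S : comPzRingType) (f : {rmorphism R -> S}) m
    (u : 'rV[R]_m) (A : 'M[R]_m) :
  map_mx f (krylov_mx u A) = krylov_mx (map_mx f u) (map_mx f A).
Proof.
by apply/row_matrixP=> i; rewrite -map_row !rowK map_mxM rmorphXn.
Qed.

(** The coordinates [q] of [u *m B] in the basis [u *m A ^+ i] define a polynomial [P] in [A] with
    [u *m P = u *m B]. Both [P] and [B] commute with [A], so they agree on the whole basis. *)
Lemma krylov_cent (R : comUnitRingType) n (u : 'rV[R]_n) (A B : 'M[R]_n) :
  \det (krylov_mx u A) \is a GRing.unit -> A *m B = B *m A ->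
  exists k : 'I_n -> R, B = \sum_i k i *: A ^+ i.
Proof.
move=> UA AB; pose q := u *m B *m invmx (krylov_mx u A).
exists (q 0); set P := \sum_i _.
have XC i : A ^+ i *m B = B *m A ^+ i by apply/esym/(@commrX _ B A i)/esym.
have PC i : A ^+ i *m P = P *m A ^+ i.
  rewrite /P mulmx_sumr mulmx_suml; apply: eq_bigr => j _.
  by rewrite -scalemxAl -scalemxAr -![_ *m _]/(_ * _) -!exprD addnC.
suff : krylov_mx u A *m B = krylov_mx u A *m P.
  by move/(congr1 (mulmx (invmx (krylov_mx u A)))); rewrite !mulKmx.
have uBP : u *m B = u *m P.
  rewrite -[LHS](mulmxKV UA) -/q mulmx_sum_row mulmx_sumr.
  by apply: eq_bigr => i _; rewrite rowK -scalemxAr.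
apply/row_matrixP=> i; rewrite !row_mul rowK -!mulmxA XC PC.
by rewrite !mulmxA uBP.
Qed.

Lemma det_krylov_sl2_e (K : fieldType) m :
  \det (krylov_mx (delta_mx 0 0) (sl2_e K m)) = 1.
Proof.
suff -> : krylov_mx (delta_mx 0 0) (sl2_e K m) = 1%:M by rewrite det1.
by apply/row_matrixP=> i; rewrite rowK sl2_e_cyclic row1.
Qed.

(** * Nonvanishing at points of an F-form *)

Section Density.

Variables (F K : fieldType) (iota : {rmorphism F -> K}).
Hypothesis infF : forall s : seq F, exists c, c \notin s.

Lemma nonroot_in_infinite_subfield (p : {poly K}) :
  p != 0 -> exists c, p.[iota c] != 0.
Proof.
move=> p0.
have [s [uniq_s szs]] : exists s : seq F, uniq s /\ size s = size p.
  elim: (size p) => [|k [s [us szs]]]; first by exists [::].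
  by have [c cs] := infF s; exists (c :: s); rewrite /= cs us szs.
suff /allPn[c _ pc] : ~~ all (fun c => root p (iota c)) s by exists c.
apply/negP=> rs.
suff : (size (map iota s) < size p)%N by rewrite size_map szs ltnn.
apply: max_poly_roots => //; last by rewrite map_inj_uniq //; apply: fmorph_inj.
by apply/allP=> _ /mapP[c /(allP rs) pc ->].
Qed.

(* The scalars k i are traded one at a time for scalars coming from F, each time
   because a nonzero univariate polynomial has a nonroot in F. *)
Lemma polynomial_nonzero_on_form (W : lmodType K) (P : W -> Prop) (f : W -> K)
    (I : Type) (b : I -> W) (r : seq I) (k : I -> K) :
  (forall A B, exists p : {poly K}, forall c, f (A + c *: B) = p.[c]) ->
  (forall A c i, P A -> P (A + iota c *: b i)) ->
  forall A, P A -> f (A + \sum_(i <- r) k i *: b i) != 0 ->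
  exists2 A, P A & f A != 0.
Proof.
move=> fpoly Pb; elim: r => [|i r IHr] A PA.
  by rewrite big_nil addr0; exists A.
rewrite big_cons addrCA addrC.
have [p pE] := fpoly (A + \sum_(i <- r) k i *: b i) (b i).
rewrite pE => pk.
have /nonroot_in_infinite_subfield[c] : p != 0.
  by apply: contraNneq pk => ->; rewrite horner0.
by rewrite -pE addrAC => /IHr; apply; apply: Pb.
Qed.

End Density.

Section LinePoly.

Variables (K : fieldType) (m n : nat).

Local Notation W := {ffun 'I_(2 ^ n) -> 'M[K]_m.+1}.

(** The same determinant is formed over [{poly K}] with ['X] in place of [c]; evaluation at [c] is a
    ring morphism, so it commutes with commutators, Krylov matrices and determinants. *)
Lemma det_krylov_iter_comm_poly (u : 'rV[K]_m.+1) (A B : W) :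
  exists p : {poly K}, forall c,
    \det (krylov_mx u (iter_comm n (codom (A + c *: B)))) = p.[c].
Proof.
pose s := codom (fun i => map_mx polyC (A i) + 'X *: map_mx polyC (B i)).
exists (\det (krylov_mx (map_mx polyC u) (iter_comm n s))) => c.
have eval_mxC k l (M : 'M[K]_(k, l)) : map_mx (horner_eval c) (map_mx polyC M) = M.
  by apply/matrixP=> i j; rewrite !mxE /horner_eval hornerC.
rewrite -[RHS]/(horner_eval c _) -det_map_mx map_krylov_mx eval_mxC.
rewrite -(@iter_comm_map _ _ (map_mx (horner_eval c))); last 2 first.
- exact: map_mxB.
- exact: map_mxM.
congr (\det (krylov_mx u (iter_comm n _))).
rewrite /s /codom /image_mem -[RHS]map_comp; apply: eq_map => i /=.
rewrite !ffunE map_mxD map_mxZ !eval_mxC; congr (_ + _ *: _).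
exact/esym/hornerX.
Qed.

End LinePoly.

(** * Sandwich maps and maximal commutative subalgebras *)

Section CentralDivisionAlgebra.

Variables (F : fieldType) (D : falgType F).
Hypotheses (divD : is_division_ring D) (centerD : 'Z({:D})%VS = 1%VS).

Lemma central_scalar (x : D) : (forall y, x * y = y * x) -> exists c : F, x = c%:A.
Proof.
move=> xC; apply/vlineP; rewrite -centerD memv_cap memvf.
by apply/centvP=> y _; apply: xC.
Qed.

(* In a relation whose first coefficient is 1, the difference of y times the
   relation at x and the relation at y x has vanishing first coefficient. *)
Lemma sandwich_free n (X : n.-tuple D) (k : 'I_n -> D) :
  free X -> (forall y, \sum_(i < n) k i * y * X`_i = 0) -> forall i, k i = 0.
Proof.
elim: n X k => [|n IHn] X k; first by move=> _ _ [].
case/tupleP: X => x X /=; rewrite free_cons => /andP[xX freeX] rel.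
have rel' y : k ord0 * y * x + \sum_(i < n) k (lift ord0 i) * y * X`_i = 0.
  by rewrite -[RHS](rel y) big_ord_recl.
suff k0 : k ord0 = 0.
  move=> i; case: (unliftP ord0 i) => [j|] -> //.
  apply: (IHn X (fun j => k (lift ord0 j)) freeX) => y.
  by have := rel' y; rewrite k0 !mul0r add0r.
apply/eqP/negPn/negP => /divD Uk.
pose l i := (k ord0)^-1 * k (lift ord0 i).
have lrel y : y * x + \sum_(i < n) l i * y * X`_i = 0.
  have /(congr1 ( *%R (k ord0)^-1)) := rel' y; rewrite mulr0 => E; rewrite -[RHS]E.
  rewrite mulrDr !mulrA mulVr // mul1r mulr_sumr.
  by congr (_ + _); apply: eq_bigr => i _; rewrite !mulrA.
(* By induction all [l j * z - z * l j] vanish, so the [l i] are scalars; the relation at [y = 1]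
   then puts [x] in the span of [X], against freeness. *)
have lC i : exists c : F, l i = c%:A.
  apply: central_scalar => z; apply/eqP; rewrite -subr_eq0; apply/eqP.
  apply: (IHn X (fun j => l j * z - z * l j) freeX) => y.
  have := congr2 (fun v w => v - z * w) (lrel (z * y)) (lrel y).
  rewrite mulr0 subrr => E; rewrite -[RHS]E.
  rewrite mulrDr !mulrA opprD addrACA subrr add0r mulr_sumr -sumrB.
  by apply: eq_bigr => j _; rewrite !mulrA !mulrBl.
have := lrel 1; rewrite mul1r => /(canRL (addrK _)); rewrite add0r => defx.
case/negP: xX; rewrite defx memvN; apply: memv_suml => i _.
have [c ->] := lC i; rewrite mulr1 -scalerAl mul1r memvZ //.
by rewrite memv_span // mem_nth // size_tuple.
Qed.

Let d : nat := \dim {:D}.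
Let b : d.-tuple D := vbasis {:D}.

(** By [sandwich_free], [Phi] is injective; its source and target both have dimension [d * d] over
    [F]. *)
Lemma sandwich_surj (phi : 'End(D)) :
  exists k : 'I_d -> D, forall y, phi y = \sum_(i < d) k i * y * b`_i.
Proof.
pose Phi (k : {ffun 'I_d -> D}) : 'End(D) :=
  \sum_(i < d) (amulr b`_i \o amull (k i))%VF.
have PhiE k y : Phi k y = \sum_(i < d) k i * y * b`_i.
  by rewrite sum_lfunE; apply: eq_bigr => i _; rewrite comp_lfunE !lfunE.
have Phi_lin : linear Phi.
  move=> a k l; apply/lfunP=> y; rewrite add_lfunE scale_lfunE !PhiE.
  rewrite scaler_sumr -big_split; apply: eq_bigr => i _ /=.
  by rewrite !ffunE !mulrDl !scalerAl.
pose Phi_L : {linear {ffun 'I_d -> D} -> 'End(D)} :=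
  HB.pack Phi (GRing.isLinear.Build _ _ _ _ Phi Phi_lin).
have ker0 : lker (linfun Phi_L) = 0%VS.
  apply/eqP/lker0P => k l; rewrite !lfunE => /= /lfunP eqkl.
  apply/ffunP=> i; apply/eqP; rewrite -subr_eq0; apply/eqP.
  apply: (sandwich_free (X := b) (k := fun i => k i - l i)) => [|y].
    exact: basis_free (vbasisP _).
  rewrite -[RHS](subrr (Phi l y)) -{1}eqkl !PhiE -sumrB.
  by apply: eq_bigr => j _; rewrite !mulrBl.
have /eqP full : limg (linfun Phi_L) == fullv.
  rewrite eqEdim subvf limg_dim_eq ?ker0 ?capv0 // !dimvf.
  rewrite [X in (X <= _)%N]/dim /= [X in (_ <= X)%N]/dim /=.
  by rewrite card_ord /d dimvf.
have /memv_imgP[k _ ->] : phi \in limg (linfun Phi_L) by rewrite full memvf.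
by exists k => y; rewrite lfunE /= PhiE.
Qed.

(** While ['C(A)] is not inside [A], adjoining an element of it gives a larger commutative
    subalgebra; dimensions are bounded by [d], so this stops. *)
Lemma exists_maximal_commutative :
  exists2 A : {aspace D}, (A <= 'C(A))%VS & ('C(A) <= A)%VS.
Proof.
have grow r : (exists2 A : {aspace D}, (A <= 'C(A))%VS & (r < \dim A)%N) \/
    exists2 A : {aspace D}, (A <= 'C(A))%VS & ('C(A) <= A)%VS.
  elim: r => [|r [[A AC rA]|]]; last by right.
    left; exists 1%AS; last by rewrite dimv1.
    apply/centvsP => _ _ /vlineP[a ->] /vlineP[c ->].
    by rewrite -!scalerAl !mul1r !scalerA mulrC.
  case: (boolP ('C(A) <= A)%VS) => [|/subvPn[x xC xA]]; first by right; exists A.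
  left; pose W := (A + <[x]>)%VS.
  have WC : (W <= 'C(W))%VS.
    apply/centvsP => u v /memv_addP[a aA [_ /vlineP[c ->] ->]].
    move=> /memv_addP[a' aA' [_ /vlineP[c' ->] ->]].
    rewrite !mulrDl !mulrDr -!scalerAl -!scalerAr !scalerA.
    have aa' : a * a' = a' * a by apply: (centvsP AC).
    rewrite (centvP xC a) // (centvP xC a') // aa' (mulrC c c').
    by rewrite !addrA; congr (_ + _); rewrite addrAC.
  (* A centralizer is a subalgebra. Used twice, with the symmetry [centvC] in between, this carries
     commutativity from [W] to the algebra it generates. *)
  have agC V : (W <= 'C(V))%VS -> (agenv W <= 'C(V))%VS.
    move=> WV; apply: agenv_sub_modl; first by rewrite -memvE centv1.
    apply/prodvP=> u v uW vC; apply: (subvP (asubv 'C(V)%AS)).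
    by rewrite memv_mul // (subvP WV).
  exists <<W>>%AS; first by apply: (agC); rewrite centvC; apply: agC.
  apply: leq_ltn_trans rA _; apply: (leq_trans _ (dimvS (sub_agenv W))).
  rewrite (ltn_leqif (dimv_leqif_sup (addvSl A <[x]>))).
  by apply: contraNN xA => /subvP; apply; rewrite memvE addvSr.
by have [[A _]|//] := grow d; rewrite ltnNge dimvS ?subvf.
Qed.

Lemma exists_self_centralizing_subfield :
    exists (K : fieldType) (kappa : {rmorphism K -> D}) (iota : {rmorphism F -> K}),
  (forall c, kappa (iota c) = c%:A) /\
  (forall x, (forall k, x * kappa k = kappa k * x) -> exists k, x = kappa k).
Proof.
have [A AC CA] := exists_maximal_commutative.
(* The identity of an [{aspace D}] may a priori differ from 1; being nonzero, it is invertible here,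
   hence equal to 1. *)
have A1 : algid A = 1.
  by apply: (unitr_algid1 (memv_algid A)); apply/divD/algid_neq0.
have mulC : commutative (@GRing.mul (subvs_of A)).
  by move=> u v; apply: val_inj; apply: (centvsP AC); apply: subvsP.
pose K0 : comUnitRingType := HB.pack (subvs_of A)
  (GRing.PzRing_hasCommutativeMul.Build (subvs_of A) mulC).
have fieldK : GRing.field_axiom K0.
  move=> x x0; apply: vsval_unitr; apply: divD.
  by apply: contraNneq x0 => x0; apply/eqP/val_inj.
pose K : fieldType := HB.pack (subvs_of A) K0
  (GRing.ComUnitRing_isField.Build K0 fieldK).
pose kappa0 (x : K) : D := vsval x.
have kappaB : {morph kappa0 : x y / x - y} by [].
have kappaM : monoid_morphism kappa0 by split=> //; apply: A1.
pose kappa : {rmorphism K -> D} := HB.pack kappa0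
  (GRing.isZmodMorphism.Build _ _ kappa0 kappaB)
  (GRing.isMonoidMorphism.Build _ _ kappa0 kappaM).
pose iota0 (c : F) : K := c%:A : subvs_of A.
have iotaE c : kappa (iota0 c) = c%:A by rewrite -A1.
have kappa_inj : injective kappa by apply: val_inj.
have iotaB : {morph iota0 : x y / x - y}.
  by move=> x y; apply: kappa_inj; rewrite rmorphB !iotaE scalerBl.
have iotaM : monoid_morphism iota0.
  split=> [|x y]; apply: kappa_inj; first by rewrite iotaE scale1r rmorph1.
  by rewrite rmorphM !iotaE -scalerAl mul1r scalerA.
pose iota : {rmorphism F -> K} := HB.pack iota0
  (GRing.isZmodMorphism.Build _ _ iota0 iotaB)
  (GRing.isMonoidMorphism.Build _ _ iota0 iotaM).
exists K, kappa, iota; split=> // x xC.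
have xA : x \in A.
  by apply: (subvP CA); apply/centvP=> y yA; apply: (xC (Subvs yA)).
by exists (Subvs xA).
Qed.

End CentralDivisionAlgebra.

(* With split_free and split_span, the F-bilinear pairing (k, x) |-> k *: rho x
   induces an isomorphism from the scalar extension of D to K onto 'M_m(K). *)
Record splitting_rep (F K : fieldType) (D : falgType F) (iota : F -> K) m
    (rho : D -> 'M[K]_m) : Prop := SplittingRep {
  splitB : {morph rho : x y / x - y};
  splitM : {morph rho : x y / x * y};
  splitZ : forall c x, rho (c *: x) = iota c *: rho x;
  split_free : forall n (X : n.-tuple D) (k : 'I_n -> K), free X ->
    \sum_(i < n) k i *: rho X`_i = 0 -> forall i, k i = 0;
  split_span : forall M, exists k : 'I_(\dim {:D}) -> K,
    M = \sum_i k i *: rho (vbasis {:D})`_i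
}.

(** * Right multiplications as matrices over K *)

Section LeftBasis.

Variables (F K : fieldType) (D : falgType F).
Variables (kappa : {rmorphism K -> D}) (iota : {rmorphism F -> K}).
Hypotheses (divD : is_division_ring D) (centerD : 'Z({:D})%VS = 1%VS).
Hypothesis kappa_iota : forall c, kappa (iota c) = c%:A.
Hypothesis kappa_cent :
  forall x, (forall k, x * kappa k = kappa k * x) -> exists k, x = kappa k.

Definition lcomb m (e : 'I_m -> D) (k : 'rV[K]_m) : D :=
  \sum_i kappa (k 0 i) * e i.

Lemma lcombB m (e : 'I_m -> D) : {morph lcomb e : k l / k - l}.
Proof.
move=> k l; rewrite /lcomb -sumrB.
by apply: eq_bigr => i _; rewrite !mxE rmorphB mulrBl.
Qed.

Lemma lcombZ m (e : 'I_m -> D) c k : lcomb e (c *: k) = kappa c * lcomb e k.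
Proof.
rewrite /lcomb mulr_sumr.
by apply: eq_bigr => i _; rewrite !mxE rmorphM mulrA.
Qed.

Lemma lcomb_sum m (e : 'I_m -> D) I (r : seq I) (k : I -> 'rV[K]_m) :
  lcomb e (\sum_(i <- r) k i) = \sum_(i <- r) lcomb e (k i).
Proof.
rewrite /lcomb exchange_big; apply: eq_bigr => i _ /=.
by rewrite summxE rmorph_sum mulr_suml.
Qed.

(** An independent family that does not span can be extended. Independence over [K] implies
    independence over [F], which bounds the length by [\dim {:D}]; the empty family cannot span
    1. *)
Lemma exists_left_basis : exists m (e : 'I_m.+1 -> D),
  (forall k, lcomb e k = 0 -> k = 0) /\ (forall x, exists k, lcomb e k = x).
Proof.
have grow r :
    (exists e : 'I_r -> D, forall k, lcomb e k = 0 -> k = 0) \/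
    exists m (e : 'I_m -> D), (forall k, lcomb e k = 0 -> k = 0) /\
      (forall x, exists k, lcomb e k = x).
  elim: r => [|r [[e e_free]|]]; last by right.
    by left; exists (fun _ => 0) => k _; apply/rowP; case.
  have [e_span|/not_all_ex_not[x xe]] :=
    classic (forall x, exists k, lcomb e k = x).
    by right; exists r, e.
  left; exists (fun i => oapp e x (unlift ord0 i)) => k.
  pose k' := \row_j k 0 (lift ord0 j).
  rewrite /lcomb big_ord_recl unlift_none /= (_ : \sum_i _ = lcomb e k'); last first.
    by apply: eq_bigr => i _; rewrite liftK mxE.
  have [k0|k0] := eqVneq (k 0 ord0) 0.
    rewrite k0 rmorph0 mul0r add0r => /e_free/rowP k'0.
    apply/rowP=> i; rewrite mxE; case: (unliftP ord0 i) => [j|] -> //.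
    by have := k'0 j; rewrite !mxE.
  move=> /(canRL (addrK _)); rewrite add0r => kx; case: xe.
  exists ((- (k 0 ord0)^-1) *: k').
  rewrite lcombZ rmorphN mulNr -mulrN -kx mulrA -rmorphM mulVf //.
  by rewrite rmorph1 mul1r.
have [[e e_free]|[[|m] [e [e_free e_span]]]] := grow (\dim {:D}).+1.
- have /eqP : free [tuple e i | i < (\dim {:D}).+1].
    apply/freeP=> c; rewrite (_ : \sum_i _ = lcomb e (\row_i iota (c i))).
      move=> /e_free/rowP c0 i; apply: (fmorph_inj iota).
      by have := c0 i; rewrite !mxE rmorph0.
    apply: eq_bigr => i _; rewrite -tnth_nth tnth_mktuple mxE kappa_iota.
    by rewrite -scalerAl mul1r.
  rewrite size_tuple => dim_e.
  have := dimvS (subvf <<[tuple e i | i < (\dim {:D}).+1]>>).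
  by rewrite dim_e ltnn.
- have [k] := e_span 1; rewrite /lcomb big_ord0 => /esym/eqP.
  by rewrite oner_eq0.
- by exists m, e.
Qed.

Variables (m : nat) (e : 'I_m -> D).
Hypotheses (e_free : forall k, lcomb e k = 0 -> k = 0)
           (e_span : forall x, exists k, lcomb e k = x).

Let e_spanb x : exists k, lcomb e k == x.
Proof. by have [k <-] := e_span x; exists k. Qed.

Definition lcoord x : 'rV[K]_m := xchoose (e_spanb x).

Lemma lcoordK x : lcomb e (lcoord x) = x.
Proof. exact/eqP/(xchooseP (e_spanb x)). Qed.

Lemma lcomb_inj : injective (lcomb e).
Proof.
move=> k l kl; apply/eqP; rewrite -subr_eq0; apply/eqP/e_free.
by rewrite lcombB kl subrr.
Qed.

(** Acting on row vectors makes this map multiplicative rather than antimultiplicative. *)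
Definition rmul_mx (a : D) : 'M[K]_m := \matrix_i lcoord (e i * a).

Lemma lcomb_rmul v a : lcomb e (v *m rmul_mx a) = lcomb e v * a.
Proof.
rewrite mulmx_sum_row lcomb_sum mulr_suml; apply: eq_bigr => i _.
by rewrite rowK lcombZ lcoordK mulrA.
Qed.

Lemma lcomb_mx_inj (A B : 'M[K]_m) :
  (forall v, lcomb e (v *m A) = lcomb e (v *m B)) -> A = B.
Proof.
by move=> AB; apply/row_matrixP=> i; apply: lcomb_inj; rewrite !rowE.
Qed.

Lemma lcomb_rmul_sum n (X : n.-tuple D) (k : 'I_n -> K) v :
  lcomb e (v *m \sum_i k i *: rmul_mx X`_i) =
  \sum_i kappa (k i) * lcomb e v * X`_i.
Proof.
rewrite mulmx_sumr lcomb_sum; apply: eq_bigr => i _.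
by rewrite -scalemxAr lcombZ lcomb_rmul mulrA.
Qed.

Lemma rmul_splitting : splitting_rep iota rmul_mx.
Proof.
split.
- move=> a b; apply: lcomb_mx_inj => v.
  by rewrite mulmxBr lcombB !lcomb_rmul mulrBr.
- move=> a b; apply: lcomb_mx_inj => v.
  rewrite [rmul_mx a * rmul_mx b]/(rmul_mx a *m rmul_mx b) mulmxA.
  by rewrite !lcomb_rmul mulrA.
- move=> c a; apply: lcomb_mx_inj => v.
  rewrite -scalemxAr lcombZ !lcomb_rmul kappa_iota.
  by rewrite -scalerAr -scalerAl mul1r.
- move=> n X k Xfree rel i; apply: (fmorph_inj kappa); rewrite rmorph0.
  apply: (sandwich_free divD centerD (k := fun i => kappa (k i)) Xfree) => y.
  have := lcomb_rmul_sum X k (lcoord y).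
  by rewrite rel mulmx0 lcoordK => <-; rewrite -(subrr 0) lcombB subrr.
move=> M.
pose phi0 y := lcomb e (lcoord y *m M).
have phi0_lin : linear phi0.
  move=> c x y; rewrite /phi0.
  have -> : lcoord (c *: x + y) = iota c *: lcoord x - (- 1) *: lcoord y.
    apply: lcomb_inj; rewrite lcombB !lcombZ !lcoordK kappa_iota.
    by rewrite rmorphN rmorph1 mulN1r opprK -scalerAl mul1r.
  rewrite mulmxBl -!scalemxAl lcombB !lcombZ kappa_iota.
  by rewrite rmorphN rmorph1 mulN1r opprK -scalerAl mul1r.
pose phi : {linear D -> D} := HB.pack phi0
  (GRing.isLinear.Build _ _ _ _ phi0 phi0_lin).
have [k kE] := sandwich_surj divD centerD (linfun phi).
have {}kE v : lcomb e (v *m M) = \sum_i k i * lcomb e v * (vbasis {:D})`_i.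
  rewrite -kE lfunE /= /phi0; congr (lcomb e (_ *m M)).
  by apply: lcomb_inj; rewrite lcoordK.
(* The map given by [M] commutes with left multiplication by [kappa c]; comparing coefficients
   through [sandwich_free], each [k i] centralizes [K]. *)
have /fin_all_exists[l kl] i : exists l, k i = kappa l.
  apply: kappa_cent => c; apply/eqP; rewrite -subr_eq0; apply/eqP.
  apply: (sandwich_free divD centerD
    (k := fun i => k i * kappa c - kappa c * k i) (basis_free (vbasisP {:D}))) => y.
  have := kE (c *: lcoord y).
  rewrite -scalemxAl !lcombZ kE lcoordK mulr_sumr => /esym/eqP.
  rewrite -subr_eq0 -sumrB => /eqP cE; rewrite -[RHS]cE.
  by apply: eq_bigr => j _; rewrite !mulrBl !mulrA.
exists l; apply: lcomb_mx_inj => v; rewrite lcomb_rmul_sum kE.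
by apply: eq_bigr => i _; rewrite kl.
Qed.

End LeftBasis.

(** * Dimension count and descent of centralizers from K to F *)

Section Splitting.

Variables (F : fieldType) (D : falgType F).
Hypotheses (divD : is_division_ring D) (centerD : 'Z({:D})%VS = 1%VS).

Lemma exists_splitting : exists (K : fieldType) (iota : {rmorphism F -> K}) m
  (rho : D -> 'M[K]_m.+1), splitting_rep iota rho.
Proof.
have [K [kappa [iota [kE kC]]]] := exists_self_centralizing_subfield divD.
have [m [e [e_free e_span]]] := exists_left_basis kE.
exists K, iota, m, (rmul_mx e_span).
exact: (rmul_splitting divD centerD kE kC e_free).
Qed.

Variables (K : fieldType) (iota : {rmorphism F -> K}) (m : nat).
Variables (rho : D -> 'M[K]_m.+1) (rho_split : splitting_rep iota rho).

(** The image under [rho] of an F-basis of [D] is a K-basis of the matrix algebra. *)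
Lemma splitting_dim : \dim {:D} = (m.+1 * m.+1)%N.
Proof.
pose X := [tuple rho (vbasis {:D})`_i | i < \dim {:D}].
have XE (i : 'I_(\dim {:D})) : X`_i = rho (vbasis {:D})`_i.
  by rewrite -tnth_nth tnth_mktuple.
have Xbasis : basis_of fullv X.
  rewrite /basis_of; apply/andP; split.
    rewrite eqEsubv subvf; apply/subvP=> M _.
    have [k ->] := split_span rho_split M; apply: memv_suml => i _.
    by rewrite -XE memvZ // memv_span // mem_nth // size_tuple.
  apply/freeP=> k rel; apply: (split_free rho_split (basis_free (vbasisP {:D}))).
  by rewrite -[RHS]rel; apply: eq_bigr => i _; rewrite XE.
by have := size_basis Xbasis; rewrite [LHS]dimvf => <-.
Qed.

Lemma split0 : rho 0 = 0.
Proof. by rewrite -(subrr 0) (splitB rho_split) subrr. Qed.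

Lemma splitD : {morph rho : x y / x + y}.
Proof.
move=> x y; rewrite -{1}[y]opprK -(sub0r y) !(splitB rho_split) split0.
by rewrite sub0r opprK.
Qed.

Lemma split_lin n (c : 'I_n -> F) (x : 'I_n -> D) :
  rho (\sum_i c i *: x i) = \sum_i iota (c i) *: rho (x i).
Proof.
rewrite (big_morph rho splitD split0).
by apply: eq_bigr => i _; apply: splitZ.
Qed.

(** Left multiplication by [rho 1] fixes every [rho x], and the identity matrix is a K-combination
    of these. *)
Lemma split1 : rho 1 = 1.
Proof.
have [k k1] := split_span rho_split 1.
rewrite -[LHS]mulr1 [X in _ * X = _]k1 mulr_sumr [RHS]k1; apply: eq_bigr => i _.
by rewrite -scalerAr -(splitM rho_split) mul1r.
Qed.

Lemma splitX x n : rho (x ^+ n) = rho x ^+ n.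
Proof.
by elim: n => [|n IHn]; rewrite ?split1 // !exprS (splitM rho_split) IHn.
Qed.

(** [rho x] is a K-combination of powers of [rho a]. Were [x] outside the F-span of the powers of
    [a], then [x] and these powers would be free over [F], and by [split_free] their images free
    over [K]. *)
Lemma cyclic_cent_span (u : 'rV[K]_m.+1) (a x : D) :
  \det (krylov_mx u (rho a)) != 0 -> a * x = x * a ->
  x \in <<[tuple (a ^+ i)%R | i < m.+1]>>%VS.
Proof.
move=> Ua ax; pose X := [tuple a ^+ i | i < m.+1].
have XE (i : 'I_m.+1) : X`_i = a ^+ i by rewrite -tnth_nth tnth_mktuple.
have [||k kE] := krylov_cent (B := rho x) (A := rho a) (u := u).
- by rewrite unitfE.
- by rewrite -![_ *m _]/(_ * _) -!(splitM rho_split) ax.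
have Xfree : free X.
  apply/freeP=> c cX.
  have : (\row_i iota (c i)) *m krylov_mx u (rho a) = 0.
    rewrite mulmx_sum_row -[RHS](mulmx0 _ u) -split0 -cX.
    rewrite split_lin mulmx_sumr.
    by apply: eq_bigr => i _; rewrite rowK mxE -scalemxAr XE splitX.
  move/(congr1 (mulmx^~ (invmx (krylov_mx u (rho a))))).
  rewrite mulmxK ?unitmxE ?unitfE // mul0mx => /rowP c0 i.
  by apply: (fmorph_inj iota); have := c0 i; rewrite !mxE rmorph0.
apply/negPn/negP=> xX.
have xXfree : free [tuple of x :: X] by rewrite /= free_cons xX.
pose l (i : 'I_m.+2) := oapp (fun j => - k j) 1 (unlift ord0 i).
have : l ord0 = 0.
  apply: (split_free rho_split xXfree); rewrite big_ord_recl /l unlift_none.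
  rewrite /= scale1r kE -big_split big1 //= => i _.
  by rewrite liftK /= XE splitX scaleNr subrr.
by rewrite /l unlift_none => /eqP; rewrite oner_eq0.
Qed.

(** The centralizer of [a], spanned by powers of [a], is commutative and lies in F(a). It is thus a
    subfield containing [F] and [a], so it equals F(a). *)
Lemma cyclic_maximal_subfield (u : 'rV[K]_m.+1) (a : D) :
  \det (krylov_mx u (rho a)) != 0 -> is_maximal_subfield (gen_subfield a).
Proof.
move=> Ua; have aspan x := cyclic_cent_span Ua (x := x).
have gen_a : gen_subfield a a by [].
have span_gen x : a * x = x * a -> gen_subfield a x.
  move=> /aspan/coord_span-> L [L1 LB LM LV LC] LF La.
  have L0 : L 0 by rewrite -(subrr 1); apply: LB.
  have LD y z : L y -> L z -> L (y + z).
    by move=> Ly Lz; rewrite -[z]opprK -(sub0r z); apply/LB/LB.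
  have LX i : L (a ^+ i).
    by elim: i => // i IHi; rewrite exprS; apply: LM.
  elim/big_rec: _ => // i y _ Ly; apply: (LD) => //.
  by rewrite -tnth_nth tnth_mktuple -mulr_algl; apply: LM.
have cent_comm x y : a * x = x * a -> a * y = y * a -> x * y = y * x.
  move=> /aspan/coord_span-> ay; rewrite mulr_suml mulr_sumr.
  apply: eq_bigr => i _; rewrite -tnth_nth tnth_mktuple.
  by rewrite -scalerAl -scalerAr; congr (_ *: _); apply/esym/commrX.
have cent_subfield : is_subfield (fun x => a * x = x * a).
  split=> [|x y ax ay|x y ax ay|x ax|//]; rewrite ?mulr1 ?mul1r //.
  - by rewrite mulrBr mulrBl ax ay.
  - by rewrite -[RHS]mulrA -ay !mulrA ax.
  - exact: commrV.
have gen_cent x : gen_subfield a x -> a * x = x * a.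
  move=> /(_ _ cent_subfield); apply=> // c.
  by rewrite -scalerAl -scalerAr mul1r mulr1.
split.
  split=> [L [] //|x y gx gy L LS LF La|x y gx gy L LS LF La
    |x gx L LS LF La|x y gx gy].
  - by case: (LS) => _ LB _ _ _; apply: LB; [apply: gx|apply: gy].
  - by case: (LS) => _ _ LM _ _; apply: LM; [apply: gx|apply: gy].
  - by case: (LS) => _ _ _ LV _; apply: LV; apply: gx.
  - by apply: cent_comm; apply: gen_cent.
move=> x; split=> [gx y gy|cx].
  by apply: cent_comm; apply: gen_cent.
by apply: span_gen; apply/esym/cx.
Qed.

End Splitting.

(** * The case of a finite center *)

Lemma finite_scalars_comm (F : fieldType) (D : falgType F) (s : seq F) :
  is_division_ring D -> (forall c, c \in s) -> commutative (@GRing.mul D).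
Proof.
move=> divD s_all; pose d := \dim {:D}.
(* Coordinates embed [D] into a finite type; the finite structure is pulled back along [f] so that
   Wedderburn's theorem applies. *)
pose f (x : D) : {ffun 'I_d -> seq_sub s} :=
  [ffun i => SeqSub (s_all (coord (vbasis {:D}) i x))].
pose g (h : {ffun 'I_d -> seq_sub s}) : D :=
  \sum_i ssval (h i) *: (vbasis {:D})`_i.
have fK : cancel f g.
  move=> x; rewrite [RHS](coord_vbasis (memvf x)).
  by apply: eq_bigr => i _; rewrite ffunE.
pose Dc : countType := HB.pack (Falgebra.sort D) (CanIsCountable fK).
have fKc : cancel (f : Dc -> _) (g : _ -> Dc) by exact: fK.
pose R : finUnitRingType := HB.pack (Falgebra.sort D) Dc (CanIsFinite fKc).
apply: (@finDomain_mulrC R) => x y xy0; case: eqVneq => //= /(divD x) Ux.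
by apply/eqP/(mulrI Ux); rewrite mulr0.
Qed.

Lemma central_comm_dim1 (F : fieldType) (D : falgType F) :
  'Z({:D})%VS = 1%VS -> commutative (@GRing.mul D) -> \dim {:D} = 1.
Proof.
move=> centerD mulC; rewrite -(dimv1 D) -centerD; congr (\dim _).
by apply/esym/capv_idPl/centvsP.
Qed.

(** * A cyclic value of v_n over an infinite center *)

Section CyclicValue.

Variables (F K : fieldType) (D : falgType F) (iota : {rmorphism F -> K}).
Variables (m : nat) (rho : D -> 'M[K]_m.+1).
Hypotheses (rho_split : splitting_rep iota rho) (m_neq0 : m.+1%:R != 0 :> K).
Hypothesis infF : forall s : seq F, exists c, c \notin s.

Lemma exists_cyclic_iter_comm n : exists a : (2 ^ n).-tuple D,
  \det (krylov_mx (delta_mx 0 0) (rho (iter_comm n a))) != 0.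
Proof.
pose W := {ffun 'I_(2 ^ n) -> 'M[K]_m.+1}.
pose f (A : W) := \det (krylov_mx (delta_mx 0 0) (iter_comm n (codom A))).
pose P (A : W) := exists a : 'I_(2 ^ n) -> D, forall i, A i = rho (a i).
(* These tuples, with one basis image in one slot, span [W] over [K], and adding F-multiples of them
   preserves [P]. *)
pose b (il : 'I_(2 ^ n) * 'I_(\dim {:D})) : W :=
  [ffun j => if j == il.1 then rho (vbasis {:D})`_il.2 else 0].
have [A [a Aa] fA] : exists2 A, P A & f A != 0.
  have [s szs sE] := sl2_triple_iter_comm (sl2_he K m) (sl2_ef m_neq0)
    (sl2_fh K m) n (mem_head _ _).
  have [k kE] : exists k : 'I_(2 ^ n) * 'I_(\dim {:D}) -> K,
      forall i : 'I_(2 ^ n), s`_i = \sum_l k (i, l) *: rho (vbasis {:D})`_l.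
    have /fin_all_exists[k kE] (i : 'I_(2 ^ n)) := split_span rho_split s`_i.
    by exists (fun il => k il.1 il.2).
  (* Starting from 0, the combination with coefficients [k] is the tuple [s] of value [sl2_e], where
     the determinant is 1. *)
  apply: (polynomial_nonzero_on_form infF (r := index_enum _) (k := k) (b := b)
    (A := 0) _ _ _ (iota := iota)).
  - exact: det_krylov_iter_comm_poly.
  - move=> A c [i l] [a Aa].
    exists (fun j => a j + (if j == i then c *: (vbasis {:D})`_l else 0)) => j.
    rewrite !ffunE Aa (splitD rho_split) /=; case: ifP => _.
      by rewrite (splitZ rho_split).
    by rewrite (split0 rho_split) scaler0.
  - by exists (fun _ => 0) => i; rewrite ffunE (split0 rho_split).
  rewrite add0r (_ : \sum_(i <- _) _ = [ffun i : 'I_(2 ^ n) => s`_i]).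
    rewrite /f (_ : codom _ = s) ?sE ?det_krylov_sl2_e ?oner_neq0 //.
    apply: (@eq_from_nth _ 0); rewrite size_codom card_ord ?szs // => i lt_i.
    by rewrite (nth_map (Ordinal lt_i)) ?size_enum_ord // ffunE nth_enum_ord.
  apply/ffunP=> j; rewrite !ffunE kE sum_ffunE.
  rewrite (eq_bigr (fun p => (k (p.1, p.2) *: b (p.1, p.2)) j)); last by case.
  rewrite -(pair_bigA _ (fun i l => (k (i, l) *: b (i, l)) j)) /=.
  rewrite (bigD1 j) //= [X in _ + X]big1 ?addr0 => [|i /negPf ij].
    by apply: eq_bigr => l _; rewrite !ffunE eqxx.
  by rewrite big1 // => l _; rewrite !ffunE eq_sym ij scaler0.
exists [tuple a i | i < 2 ^ n].
rewrite -(iter_comm_map (splitB rho_split) (splitM rho_split)).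
suff -> : [seq rho x | x <- [tuple a i | i < 2 ^ n]] = codom A by [].
by rewrite /= -map_comp; apply: eq_map => i; rewrite /= -Aa.
Qed.

End CyclicValue.

Unset Implicit Arguments.

Theorem theorem10 (F : fieldType) (D : falgType F)
    (divD : is_division_ring D)
    (centerD : 'Z({:D})%VS = 1%VS)
    (charF : [pchar F] =i pred0 \/
             exists2 p : nat, p \in [pchar F] & ~~ (p %| \dim {:D})%N)
    (n : nat) (n_gt0 : (0 < n)%N) :
  exists a : (2 ^ n).-tuple D,
    is_maximal_subfield (gen_subfield (iter_comm n a)).
Proof.
have [K [iota [m [rho rho_split]]]] := exists_splitting divD centerD.
have dimD := splitting_dim rho_split.
(* As [m.+1] divides [\dim {:D}], a prime not dividing the dimension does not divide [m.+1]. *)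
have m_neq0 : m.+1%:R != 0 :> K.
  rewrite -(rmorph_nat iota) fmorph_eq0.
  case: charF => [/pcharf0P-> //|[p pF]].
  by rewrite dimD -(dvdn_pcharf pF); apply: contraNN => /dvdn_mulr->.
suff [a Ua] : exists a : (2 ^ n).-tuple D,
    \det (krylov_mx (delta_mx 0 0) (rho (iter_comm n a))) != 0.
  exists a; exact: (cyclic_maximal_subfield rho_split Ua).
have [infF|finF] := classic (forall s : seq F, exists c, c \notin s).
  exact (exists_cyclic_iter_comm rho_split m_neq0 infF n).
have [s s_all] : exists s : seq F, forall c, c \in s.
  have [s sP] := not_all_ex_not _ _ finF; exists s => c.
  by apply/negPn/negP=> cs; apply: sP; exists c.
have dim1 := central_comm_dim1 centerD (finite_scalars_comm divD s_all).
have {dimD dim1} m0 : m = 0%N by case: (m) dimD => // k; rewrite dim1 mulSn.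
(* For [m = 0] the Krylov matrix is the 1 by 1 identity whatever the tuple, so zeros serve. *)
exists [tuple 0 | _ < 2 ^ n]; rewrite m0 in rho rho_split m_neq0 *.
by rewrite det_mx11 mxE expr0 mulmx1 mxE oner_neq0.
Qed.
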